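(* Let $G$ be a countable group of homeomorphisms of a Hausdorff space $X$. Then for every $H\in\mathrm{Sub}(G)$, one of the following possibilities holds: (i) the closure of the conjugacy class $\mathcal{C}(H)$ in $\mathrm{Sub}(G)$ contains the trivial subgroup; (ii) there exists a non-empty open $U\subset X$ such that $H$ admits a finite index subgroup of $G_U$ as a subquotient.
   Context: $\mathrm{Sub}(G)$ is the space of all subgroups of $G$ with the topology induced from the product topology on $\{0,1\}^G$ (Chabauty topology). $\mathcal{C}(H)=\{gHg^{-1} : g\in G\}$. For $U\subset X$, the rigid stabilizer $G_U$ is the subgroup of $G$ of elements fixing $X\setminus U$ pointwise. A group $Q$ is a subquotient of a group $H$ if there is a subgroup $K\le H$ such that $Q$ is a quotient of $K$. *)

(* Defs.v *)
From HB Require Import structures.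
From mathcomp Require Import all_boot.
From mathcomp Require Import all_classical topology.

Set Implicit Arguments.
Unset Strict Implicit.
Unset Printing Implicit Defensive.

Local Open Scope classical_set_scope.
Local Open Scope group_scope.

(* Sub(G) is a subset of {0,1}^G; `{ptws G -> bool}` carries the product
   topology and `set_type` the induced one. *)
Definition Subg (G : groupType) : Type :=
  set_type [set A : {ptws G -> bool} | group_closed (A : pred G)].

HB.instance Definition _ (G : groupType) := Topological.copy (Subg G)
  (set_type [set A : {ptws G -> bool} | group_closed (A : pred G)]).

Definition mem_subg (G : groupType) (H : Subg G) : pred G := set_val H.

Lemma mem_subg_closed (G : groupType) (H : Subg G) : group_closed (mem_subg H).
Proof. by have /set_mem := svalP H. Qed.

Definition mk_subg (G : groupType) (A : pred G) (A_closed : group_closed A) :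
  Subg G := exist _ (A : {ptws G -> bool}) (mem_set A_closed).

Definition subg_type (G : groupType) (H : Subg G) : Type := {x : G | mem_subg H x}.

HB.instance Definition _ (G : groupType) (H : Subg G) :=
  SubChoice.on (subg_type H).
HB.instance Definition _ (G : groupType) (H : Subg G) :=
  SubChoice_isSubGroup.Build G (mem_subg H) (subg_type H) (mem_subg_closed H).

Definition subg_group (G : groupType) (H : Subg G) : groupType := subg_type H.
Coercion subg_group : Subg >-> groupType.

Lemma trivial_closed (G : groupType) : group_closed (pred1 (1 : G)).
Proof.
split; first by rewrite inE.
by move=> x y; rewrite !inE => /eqP-> /eqP->; rewrite divgg.
Qed.

Definition trivial_subg (G : groupType) : Subg G := mk_subg (@trivial_closed G).

Definition conj_class (G : groupType) (H : Subg G) : set (Subg G) :=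
  [set K : Subg G | exists g : G,
    [set` mem_subg K] = [set g * h * g^-1 | h in [set` mem_subg H]]].

Definition finite_index (G : groupType) (L : Subg G) : Prop :=
  finite_set [set [set g * l | l in [set` mem_subg L]] | g in [set: G]].

Definition is_quotient (Q K : groupType) : Prop :=
  exists f : {multiplicative K -> Q}, range f = [set: Q].

Definition subquotient (Q H : groupType) : Prop :=
  exists K : Subg H, is_quotient Q K.

Definition homeomorphism (X Y : topologicalType) (f : X -> Y) : Prop :=
  continuous f /\
  exists g : Y -> X, [/\ cancel f g, cancel g f & continuous g].

Section Homeo.
Variable X : topologicalType.

Record homeo := Homeo {
  homeo_fun :> X -> X;
  homeoP : homeomorphism homeo_fun }.

Lemma homeo_ext (f g : homeo) : homeo_fun f =1 homeo_fun g -> f = g.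
Proof.
case: f g => [f fP] [g gP] /= /funext fg.
by case: _ / fg gP => gP; congr Homeo; exact: Prop_irrelevance.
Qed.

HB.instance Definition _ := gen_eqMixin homeo.
HB.instance Definition _ := gen_choiceMixin homeo.

Lemma homeomorphism_id : homeomorphism (@id X).
Proof.
by split; [move=> x; exact: cvg_id | exists id; split=> // x; exact: cvg_id].
Qed.

Lemma homeomorphism_comp (f g : homeo) : homeomorphism (f \o g).
Proof.
case: (homeoP f) (homeoP g) => [cf [f' [fK f'K cf']]] [cg [g' [gK g'K cg']]].
split; first by move=> x; apply: continuous_comp; [exact: cg | exact: cf].
exists (g' \o f'); split; [exact: can_comp|exact: can_comp|].
by move=> x; apply: continuous_comp; [exact: cf' | exact: cg'].
Qed.

Definition homeo_inv_fun (f : homeo) : X -> X := sval (cid (homeoP f).2).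

Lemma homeo_inv_funP (f : homeo) :
  [/\ cancel f (homeo_inv_fun f), cancel (homeo_inv_fun f) f
    & continuous (homeo_inv_fun f)].
Proof. exact: svalP (cid (homeoP f).2). Qed.

Lemma homeomorphism_inv (f : homeo) : homeomorphism (homeo_inv_fun f).
Proof.
case: (homeo_inv_funP f) => fK f'K cf'; split=> //.
by exists f; split=> //; exact: (homeoP f).1.
Qed.

Definition homeo_one : homeo := Homeo homeomorphism_id.
Definition homeo_mul (f g : homeo) : homeo := Homeo (homeomorphism_comp f g).
Definition homeo_inv (f : homeo) : homeo := Homeo (homeomorphism_inv f).

Lemma homeo_mulA : associative homeo_mul.
Proof. by move=> f g h; exact: homeo_ext. Qed.

Lemma homeo_mul1 : left_id homeo_one homeo_mul.
Proof. by move=> f; exact: homeo_ext. Qed.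

Lemma homeo_mulr1 : right_id homeo_one homeo_mul.
Proof. by move=> f; exact: homeo_ext. Qed.

Lemma homeo_mulV : left_inverse homeo_one homeo_inv homeo_mul.
Proof.
by move=> f; apply: homeo_ext => x /=; case: (homeo_inv_funP f) => ->.
Qed.

Lemma homeo_mulrV : right_inverse homeo_one homeo_inv homeo_mul.
Proof.
by move=> f; apply: homeo_ext => x /=; case: (homeo_inv_funP f) => _ ->.
Qed.

HB.instance Definition _ := isGroup.Build homeo
  homeo_mulA homeo_mul1 homeo_mulr1 homeo_mulV homeo_mulrV.

End Homeo.

Section RigidStabilizer.
Variables (X : topologicalType) (G : Subg (homeo X)) (U : set X).

Definition rigid_pred : pred G :=
  fun g => `[< forall x, (~` U) x -> (val g : homeo X) x = x >].

Lemma rigid_closed : group_closed rigid_pred.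
Proof.
split; first by apply/asboolP.
move=> g h /asboolP gU /asboolP hU; apply/asboolP => x Ux.
rewrite -[in LHS](hU x Ux) /=.
by case: (homeo_inv_funP (val h)) => -> _ _; exact: gU.
Qed.

Definition rigid_stab : Subg G := mk_subg rigid_closed.

End RigidStabilizer.

(* Main.v *)
Require Import Defs.
From HB Require Import structures.
From mathcomp Require Import all_boot all_classical topology.

(** If the closure of the conjugacy class of H misses the trivial subgroup, then
    H is confined: some finite set P of nontrivial elements of G meets every
    conjugate of H. At an isolated point x of X the rigid stabilizer of {x} is
    trivial, so assume that X is perfect. Then there are non-empty open sets
    U_p, for p in P, that are pairwise disjoint and all disjoint from every
    p(U_p) ([displaced_opens]): an open set of moved points is infinite, so a
    point x_p moved by p can be chosen away from the finitely many positions
    that would collide with the earlier choices, and Hausdorff separation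
    thickens the points to open sets.

    Suppose that g and h in G both fix p(U_p) pointwise and act on U_p as the
    elements a and b of the rigid stabilizer G_{U_p}. Then
    (g p g^-1)(h p h^-1)^-1 acts on p(U_p) as p a^-1 b p^-1. So if both
    conjugates of p lie in H, then H contains an element acting on p(U_p) as
    the copy of a^-1 b transported by p. Either every element of G_{U_p} has its
    transported copy induced by H, and then G_{U_p} is a quotient of a subgroup
    of H ([shadow_subquotient]), or the elements a that can occur lie in one
    coset of a proper subgroup, and some k_p in G_{U_p} cannot occur
    ([coset_avoid]).

    If the second case held for every p in P, the product h of the k_p would
    act on each U_p as k_p and fix each p(U_p) pointwise ([rigid_product]), so
    no h p h^-1 would lie in H, against confinement. Hence the whole of some
    G_{U_p}, a subgroup of index one, is a subquotient of H. *)

Set Implicit Arguments.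
Unset Strict Implicit.
Unset Printing Implicit Defensive.

Local Open Scope classical_set_scope.
Local Open Scope group_scope.

(** * Confined subgroups in the Chabauty topology *)

(** The filter of agreement with f on finite sets converges to f coordinatewise,
    hence in the product topology; so it refines the neighbourhoods of f. *)
Lemma ptws_bool_nbhs (T : choiceType) (f : {ptws T -> bool})
    (A : set {ptws T -> bool}) :
  nbhs f A -> exists s : seq T, forall h, {in s, h =1 f} -> A h.
Proof.
pose F : set_system {ptws T -> bool} :=
  filter_from setT
    (fun s : seq T => [set h : {ptws T -> bool} | {in s, h =1 f}]).
have FF : Filter F.
  apply: filter_from_filter; first by exists [::].
  move=> s t _ _; exists (s ++ t) => // h hst; split=> x xs;
    by apply: hst; rewrite mem_cat xs ?orbT.
suff /[apply] -[s _ sA] : F --> f by exists s.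
apply/cvg_sup => i B /=.
rewrite (@nbhsE (initial_topology (fun h : T -> bool => h i))).
move=> -[_ [[O _ <-] Of] OB].
by exists [:: i] => // h /(_ i (mem_head _ _)) hi; apply: OB; rewrite /= hi.
Qed.

Lemma subg_nbhs (G : groupType) (H : Subg G) (A : set (Subg G)) :
  nbhs H A -> exists s : seq G, forall K : Subg G,
    {in s, mem_subg K =1 mem_subg H} -> A K.
Proof.
rewrite nbhsE => -[_ [[O oO <-] OH] OA].
have [s sO] := @ptws_bool_nbhs G _ O (open_nbhs_nbhs (conj oO OH)).
by exists s => K KH; apply: OA; exact: sO.
Qed.

Lemma conj_closed (G : groupType) (H : Subg G) (g : G) :
  group_closed ((fun x => mem_subg H (g * x * g^-1)) : pred G).
Proof.
have [H1 HB] := mem_subg_closed H.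
split; first by rewrite unfold_in mulg1 divgg.
move=> x y; rewrite !unfold_in => xH yH; move: (HB _ _ xH yH); rewrite unfold_in.
by rewrite !invgM !invgK !mulgA mulgVK.
Qed.

(** Conjugates of H approach the trivial subgroup as soon as they avoid arbitrary
    finite sets of nontrivial elements; P witnesses the failure. *)
Lemma notin_closure_confined (G : groupType) (H : Subg G) :
  ~ closure (conj_class H) (trivial_subg G) ->
  exists2 P : seq G, {in P, forall p, p != 1} &
    forall g : G, exists2 p, p \in P & mem_subg H (g * p * g^-1).
Proof.
move=> /existsNP[A /not_implyP[/subg_nbhs[s sA] CA]].
exists [seq p <- s | p != 1] => [p|g]; first by rewrite mem_filter => /andP[].
apply: contrapT => noP; apply: CA.
pose K := mk_subg (@conj_closed G H g).
exists K; split.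
  exists g^-1; apply/seteqP; split => [x xK|_ [y yH <-]].
    by exists (g * x * g^-1) => //; rewrite invgK !mulgA mulVg mul1g mulgVK.
  change (mem_subg H (g * (g^-1 * y * g^-1^-1) * g^-1)).
  by rewrite invgK !mulgA mulgV mul1g mulgK.
apply: sA => p ps; apply/idP/idP => [pK|/eqP->].
  apply: contra_notT noP => p1; exists p => //.
  by rewrite mem_filter p1.
by have [] := mem_subg_closed K.
Qed.

(** * Finite sets of points in Hausdorff spaces *)

Section HausdorffPoints.
Variable X : topologicalType.
Hypothesis X_hausdorff : hausdorff_space X.

(** O t is the intersection of the neighbourhoods of t that separate it from the
    finitely many other points of S. *)
Lemma separate_points (S : seq X) :
  exists2 O : X -> set X, forall t, open (O t) /\ O t t &
    {in S &, forall s t, s != t -> O s `&` O t = set0}.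
Proof.
have VW (st : X * X) : exists AB : set X * set X, st.1 != st.2 ->
    [/\ open AB.1, open AB.2, AB.1 st.1, AB.2 st.2 & AB.1 `&` AB.2 = set0].
  have [->|st12] := eqVneq st.1 st.2; first by exists (set0, set0).
  move: X_hausdorff; rewrite open_hausdorff => /(_ _ _ st12).
  by move=> [AB [/set_mem ? /set_mem ?] [? ? /eqP ?]]; exists AB.
have [V VP] := choice VW.
exists (fun t =>
  \big[setI/setT]_(s <- S | s != t) ((V (t, s)).1 `&` (V (s, t)).2)).
  move=> t; split; first (apply: (big_ind open); first exact: openT).
  - exact: openI.
  - move=> s st; have ts : t != s by rewrite eq_sym.
    have [_ oVst _ _ _] := VP (s, t) st; have [oVts _ _ _ _] := VP (t, s) ts.
    exact: openI.
  apply: (big_ind (fun A : set X => A t)) => // s st.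
  have ts : t != s by rewrite eq_sym.
  by have [_ _ _ Vst _] := VP (s, t) st; have [_ _ Vts _ _] := VP (t, s) ts.
move=> s t sS tS st; apply/seteqP; split=> // x [].
rewrite (big_rem t)//= eq_sym st => -[[st1 _] _].
rewrite (big_rem s)//= st => -[[_ st2] _].
by have [_ _ _ _ /seteqP[+ _]] := VP (s, t) st => /(_ x); apply.
Qed.

Hypothesis X_perfect : forall x : X, ~ open [set x].

(** Finite sets are closed, so a finite open set consists of isolated points. *)
Lemma perfect_open_infinite (A : set X) : open A -> A !=set0 -> infinite_set A.
Proof.
move=> oA [x Ax] fA; apply: (X_perfect (x := x)).
have -> : [set x] = A `\` (A `\ x).
  apply/seteqP; split=> [_ ->|y [Ay nAy]]; first by split=> // -[_]; exact.
  by apply: contrapT => yx; exact: nAy.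
apply: openI => //; apply: closed_openC.
apply: (accessible_finite_set_closed.1 (hausdorff_accessible X_hausdorff)).
exact: sub_finite_set fA.
Qed.

Lemma perfect_open_avoid (A : set X) (S : seq X) :
  open A -> A !=set0 -> exists2 y, A y & y \notin S.
Proof.
move=> oA A0; apply: contrapT => noy; apply: (perfect_open_infinite oA A0).
apply: (@sub_finite_set _ _ [set` S]) => // y Ay /=.
by apply: contrapT => /negP yS; apply: noy; exists y.
Qed.

End HausdorffPoints.

(** * Rigid stabilizers as subquotients *)

Section Action.
Variables (X : topologicalType) (G : Subg (homeo X)).
Implicit Types (g h p m : G) (x : X) (U : set X).

Definition act g : X -> X := homeo_fun (val g).

Lemma act1 x : act 1 x = x. Proof. by []. Qed.

Lemma actM g h x : act (g * h) x = act g (act h x). Proof. by []. Qed.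

Lemma actK g : cancel (act g) (act g^-1).
Proof. by move=> x; rewrite -actM mulVg. Qed.

Lemma actVK g : cancel (act g^-1) (act g).
Proof. by move=> x; rewrite -actM mulgV. Qed.

Lemma act_continuous g : continuous (act g).
Proof. exact: (homeoP (val g)).1. Qed.

Lemma act_inj g : injective (act g).
Proof. exact: can_inj (actK g). Qed.

Lemma act_ext g h : act g =1 act h -> g = h.
Proof. by move=> gh; apply: val_inj; exact: homeo_ext. Qed.

Lemma act_moves g : g != 1 -> exists x, act g x <> x.
Proof.
move=> g1; apply: contrapT => /forallNP gE; move/eqP: g1; apply.
by apply: act_ext => x; exact: contrapT (gE x).
Qed.

Lemma rigid_outside U (m : rigid_stab G U) x : ~ U x -> act (val m) x = x.
Proof. by have /asboolP := valP m; exact. Qed.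

Lemma rigid_inside U (m : rigid_stab G U) x : U x -> U (act (val m) x).
Proof.
move=> Ux; apply: contrapT => nU.
by apply: (nU); rewrite (act_inj (rigid_outside m nU)).
Qed.

Lemma rigid_ext U (m n : rigid_stab G U) :
  (forall x, U x -> act (val m) x = act (val n) x) -> m = n.
Proof.
move=> mn; apply: val_inj; apply: act_ext => x.
by have [/mn//|nU] := pselect (U x); rewrite !rigid_outside.
Qed.

(** [shadows U p gamma m] says that p^-1 gamma p and m agree on U: gamma acts on
    the displaced copy p(U) as m acts on U. *)
Definition shadows U p (gamma m : G) :=
  forall x, U x -> act gamma (act p x) = act p (act m x).

Lemma full_closed (K : groupType) : group_closed (predT : pred K).
Proof. by split. Qed.

Section Subquotient.
Variables (H : Subg G) (U : set X) (p : G).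

Definition shadow_pred : pred H :=
  fun gamma => `[< exists m : rigid_stab G U, shadows U p (val gamma) (val m) >].

Lemma shadow_closed : group_closed shadow_pred.
Proof.
split; first by apply/asboolP; exists 1.
move=> a b /asboolP[m am] /asboolP[n bn]; apply/asboolP; exists (m / n).
move=> x Ux.
have Unx : U (act (val n^-1) x) by exact: rigid_inside.
rewrite [val (a / b)]gmulfM [val (m / n)]gmulfM !actM -am//; congr act.
apply: (can_inj (actK (val b))); rewrite bn// gmulfV.
by rewrite actVK gmulfV actVK.
Qed.

Definition shadow_subg : Subg H := mk_subg shadow_closed.

Definition full_rigid : Subg (rigid_stab G U) :=
  mk_subg (full_closed (rigid_stab G U)).

(** A rigid element is determined by its action on U, so the element of G_U that
    gamma shadows is unique, and choosing it is a homomorphism. *)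
Definition shadow_map (gamma : shadow_subg) : full_rigid :=
  exist _ (sval (cid (asboolW (valP gamma)))) isT.

Lemma shadow_mapP (gamma : shadow_subg) :
  shadows U p (val (val gamma)) (val (val (shadow_map gamma))).
Proof. exact: svalP (cid (asboolW (valP gamma))). Qed.

Lemma shadow_map_eq (gamma : shadow_subg) (m : full_rigid) :
  shadows U p (val (val gamma)) (val (val m)) -> shadow_map gamma = m.
Proof.
move=> gm; apply/val_inj/rigid_ext => x Ux; apply: (@act_inj p).
by rewrite -shadow_mapP// gm.
Qed.

Lemma shadow_mapM : {morph shadow_map : a b / a * b}.
Proof.
move=> a b; apply: shadow_map_eq => x Ux.
rewrite [val (val (a * b))]/(_ * _) actM shadow_mapP// shadow_mapP//.
exact: rigid_inside.
Qed.

HB.instance Definition _ := isMultiplicative.Build _ _ shadow_map shadow_mapM.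

(** The elements of H that preserve p(U) and act on it as some element of G_U
    form a subgroup, which maps onto G_U as soon as every element of G_U is
    shadowed. *)
Lemma shadow_subquotient :
  (forall m : rigid_stab G U,
     exists2 gamma : G, mem_subg H gamma & shadows U p gamma (val m)) ->
  exists L : Subg (rigid_stab G U), finite_index L /\ subquotient L H.
Proof.
move=> Hm; exists full_rigid; split.
  apply: (sub_finite_set _ (finite_set1 setT)) => _ [g _ <-] /=.
  apply/seteqP; split=> // y _; exists (g^-1 * y) => //.
  by rewrite mulgA mulgV mul1g.
exists shadow_subg, (shadow_map : {multiplicative shadow_subg -> full_rigid}).
apply/seteqP; split=> // m _.
have [gamma Hgamma gm] := Hm (val m).
have gS : shadow_pred (Sub gamma Hgamma : H).
  by apply/asboolP; exists (val m).
by exists (Sub (Sub gamma Hgamma : H) gS) => //; exact: shadow_map_eq.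
Qed.

End Subquotient.

(** * Displacing open sets *)

Section Displacement.
Hypothesis X_hausdorff : hausdorff_space X.
Hypothesis X_perfect : forall x : X, ~ open [set x].

Lemma moved_open p : p != 1 ->
  exists W : set X, [/\ open W, W !=set0 & forall x, W x -> act p x != x].
Proof.
move=> /act_moves[x /eqP px].
have [O OP disjO] := separate_points X_hausdorff [:: act p x; x].
exists (O x `&` act p @^-1` O (act p x)); split.
- apply: openI; first by case: (OP x).
  apply: open_comp; last by case: (OP (act p x)).
  by move=> y _; exact: act_continuous.
- by exists x; split; [case: (OP x)|case: (OP (act p x))].
move=> y [Oy Opy]; apply: contraPneq disjO => pyy.
have {}Opy : O (act p x) y by rewrite -[y]pyy.
move=> /(_ (act p x) x); rewrite !inE !eqxx orbT => /(_ isT isT px) /seteqP[+ _].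
by move=> /(_ y); apply.
Qed.

(** Adding p to the list, x_p must avoid the points x_q, so that it is new; the
    points p^-1 x_q, so that p does not carry it to an old point; and the points
    q x_q, so that no old point is carried to it. *)
Lemma displaced_points (x0 : X) (P : seq G) : {in P, forall p, p != 1} ->
  exists x : G -> X, {in P &, forall p q,
    act p (x p) != x q /\ (p != q -> x p != x q)}.
Proof.
elim: P => [_|p P IH P1]; first by exists (fun=> x0).
have [|x xP] := IH; first by move=> q qP; apply: P1; rewrite inE qP orbT.
have [pP|pP] := boolP (p \in P).
  by exists x => q r; rewrite !inE => /predU1P[->|qP] /predU1P[->|rP]; exact: xP.
have [W [oW W0 Wp]] := moved_open (P1 p (mem_head _ _)).
pose S := [seq x q | q <- P] ++ [seq act p^-1 (x q) | q <- P]
  ++ [seq act q (x q) | q <- P].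
have [y /Wp py] := perfect_open_avoid X_hausdorff X_perfect S oW W0.
rewrite !mem_cat !negb_or => /and3P[yx ypx yqx].
exists (fun q => if q == p then y else x q) => q r; rewrite !inE.
have neP s : s \in P -> (s == p) = false.
  by move=> sP; apply: contraNF pP => /eqP <-.
move=> /predU1P[->|qP] /predU1P[->|rP]; rewrite ?eqxx ?neP//.
- split=> [|_].
  + by apply: contraNneq ypx => /(canRL (actK p)) ->; exact: map_f.
  + by apply: contraNneq yx => ->; exact: map_f.
- split=> [|_].
  + by apply: contraNneq yqx => <-; exact: (map_f (fun q => act q (x q))).
  + by apply: contraNneq yx => <-; exact: map_f.
- exact: xP.
Qed.

(** Separate all the points x_p and p x_p at once; U_p is then the part of the
    neighbourhood of x_p that p sends into the neighbourhood of p x_p. *)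
Lemma displaced_opens (x0 : X) (P : seq G) : {in P, forall p, p != 1} ->
  exists U : G -> set X,
    [/\ {in P, forall p, open (U p) /\ U p !=set0},
        {in P &, forall p q x, U p x -> ~ U q (act p x)} &
        {in P &, forall p q x, p != q -> U p x -> ~ U q x}].
Proof.
move=> /(displaced_points x0)[x xP].
have [O OP disjO] := separate_points X_hausdorff
  ([seq x p | p <- P] ++ [seq act p (x p) | p <- P]).
have O0 s t y : s \in [seq x p | p <- P] ++ [seq act p (x p) | p <- P] ->
    t \in [seq x p | p <- P] ++ [seq act p (x p) | p <- P] ->
    s != t -> O s y -> ~ O t y.
  move=> sS tS st Os Ot; have /seteqP[+ _] := disjO _ _ sS tS st.
  by move=> /(_ y); apply.
exists (fun p => O (x p) `&` act p @^-1` O (act p (x p))); split.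
- move=> p _; split.
    apply: openI; first by case: (OP (x p)).
    apply: open_comp; last by case: (OP (act p (x p))).
    by move=> y _; exact: act_continuous.
  by exists (x p); split; [case: (OP (x p))|case: (OP (act p (x p)))].
- move=> p q pP qP y [_ Opy] [Oqy _].
  have [pq _] := xP p q pP qP; apply: (O0 _ _ (act p y) _ _ pq) => //.
    by rewrite mem_cat (map_f (fun p => act p (x p)))// orbT.
  by rewrite mem_cat map_f.
- move=> p q pP qP y pq [Oy _] [Oqy _].
  have [_ /(_ pq) xpq] := xP p q pP qP; apply: (O0 _ _ y _ _ xpq) => //;
    by rewrite mem_cat map_f.
Qed.

End Displacement.

(** * Elements prescribed on disjoint open sets *)

(** If g and h both fix p(U) pointwise, act on U as a and b, and conjugate p into
    H, then (g p g^-1)(h p h^-1)^-1 is an element of H that shadows a^-1 b. When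
    m is not shadowed by H, a and a m can therefore not both occur: k is a m if
    some a occurs, and arbitrary otherwise. *)
Lemma coset_avoid (H : Subg G) U p :
  (exists m : rigid_stab G U,
    forall gamma : G, mem_subg H gamma -> ~ shadows U p gamma (val m)) ->
  exists k : rigid_stab G U, forall g,
    (forall x, U x -> act g (act p x) = act p x) ->
    (forall x, U x -> act g x = act (val k) x) ->
    ~ mem_subg H (g * p * g^-1).
Proof.
move=> [m mH].
have [[a [g [gp ga gH]]]|no] := pselect (exists a : rigid_stab G U, exists g,
    [/\ forall x, U x -> act g (act p x) = act p x,
        forall x, U x -> act g x = act (val a) x &
        mem_subg H (g * p * g^-1)]); last first.
  by exists 1 => g gp g1 gH; apply: no; exists 1, g.
exists (a * m) => h hp ham hH.
apply: (mH (g * p * g^-1 * (h * p * h^-1)^-1)).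
  by have [_] := mem_subg_closed H; exact.
move=> x Ux.
have Um : U (act (val m) x) by exact: rigid_inside.
have hVp : act h^-1 (act p x) = act p x by rewrite -{1}hp// actK.
rewrite !invgM invgK !actM hVp actK ham// gmulfM actM -ga//.
by rewrite actK gp.
Qed.

(** The factors have disjoint supports, so they do not disturb one another: a
    point of U p stays in U p under k p, hence outside all the other U q. *)
Lemma rigid_product (P : seq G) (U : G -> set X)
    (k : forall p, rigid_stab G (U p)) :
  {in P &, forall p q x, p != q -> U p x -> ~ U q x} ->
  exists h : G, {in P, forall p x, U p x -> act h x = act (val (k p)) x} /\
    (forall x, {in P, forall p, ~ U p x} -> act h x = x).
Proof.
elim: P => [_|p P IH disjU]; first by exists 1.
have [pP|pP] := boolP (p \in P).
  have [|h [hk h1]] := IH.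
    by move=> q r qP rP; apply: disjU; rewrite inE ?qP ?rP orbT.
  exists h; split=> [q|x noU].
    by rewrite inE => /predU1P[->|]; exact: hk.
  by apply: h1 => q qP; apply: noU; rewrite inE qP orbT.
have [|h [hk h1]] := IH.
  by move=> q r qP rP; apply: disjU; rewrite inE ?qP ?rP orbT.
exists (val (k p) * h); split=> [q|x noU]; last first.
  rewrite actM h1 ?rigid_outside//; first exact: noU (mem_head _ _).
  by move=> q qP; apply: noU; rewrite inE qP orbT.
rewrite inE => /predU1P[->|qP] x Ux; rewrite actM.
  rewrite h1// => r rP; apply: (disjU p r) Ux; rewrite ?mem_head//.
    by rewrite inE rP orbT.
  by apply: contraNneq pP => ->.
rewrite (hk q qP x Ux) rigid_outside//.
apply: (disjU q p _ _ _ _ (rigid_inside (k q) Ux)); rewrite ?mem_head//.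
  by rewrite inE qP orbT.
by apply: contraNneq pP => <-.
Qed.

End Action.

Theorem theorem3p5 (X : topologicalType) (X_hausdorff : hausdorff_space X)
    (G : Subg (homeo X)) (G_countable : countable [set: G]) (H : Subg G) :
  closure (conj_class H) (trivial_subg G) \/
  exists U : set X, [/\ open U, U !=set0 &
    exists L : Subg (rigid_stab G U), finite_index L /\ subquotient L H].
Proof.
have [|/notin_closure_confined[P P1 PH]] :=
  pselect (closure (conj_class H) (trivial_subg G)); first by left.
right; have [[x ox]|no_isolated] := pselect (exists x : X, open [set x]).
  exists [set x]; split=> //; first by exists x.
  (* Everything in G_{x} fixes x, so the identity shadows it. *)
  apply: (@shadow_subquotient _ _ _ _ 1) => m; exists 1.
    by have [] := mem_subg_closed H.
  by move=> y xy; rewrite !act1 (rigid_inside m xy) xy.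
have X_perfect (x : X) : ~ open [set x].
  by move=> ox; apply: no_isolated; exists x.
(* Confinement at 1 makes P, and hence X, nonempty. *)
have [p1 p1P _] := PH 1.
have [x0 _] := act_moves (P1 _ p1P).
have [U [Uo Up Ud]] := displaced_opens X_hausdorff X_perfect x0 P1.
apply: contrapT => noU.
have bad p : exists k : rigid_stab G (U p), p \in P -> forall g,
    (forall x, U p x -> act g (act p x) = act p x) ->
    (forall x, U p x -> act g x = act (val k) x) ->
    ~ mem_subg H (g * p * g^-1).
  have [pP|_] := boolP (p \in P); last by exists 1.
  suff /coset_avoid[k kP] : exists m : rigid_stab G (U p),
    forall gamma : G, mem_subg H gamma -> ~ shadows (U p) p gamma (val m).
    by exists k.
  apply: contrapT => all_m; apply: noU; have [oU U0] := Uo p pP.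
  exists (U p); split=> //; apply: (@shadow_subquotient _ _ _ _ p) => m.
  apply: contrapT => no_gamma; apply: all_m; exists m => gamma Hgamma gm.
  by apply: no_gamma; exists gamma.
pose k p := sval (cid (bad p)).
have [h [hk h1]] := rigid_product k Ud.
have [p pP] := PH h.
apply: (svalP (cid (bad p)) pP) => x Ux; last exact: hk.
by apply: h1 => q qP; exact: Up Ux.
Qed.
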